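(* Let $\{u_i\}_{i\in I}$ be a unit norm $18$-tight frame for a Hilbert space $\mathbb{H}$, i.e. $\|u_i\|=1$ for all $i\in I$ and $\sum_{i\in I}|\langle u,u_i\rangle|^2=18\|u\|^2$ for all $u\in\mathbb{H}$. Then there is a partition $\{S_1,S_2\}$ of $I$ such that for $j=1,2$ the family $\{u_i\}_{i\in S_j}$ is a frame for $\mathbb{H}$ with frame bounds $2,16$, that is, $$2\|u\|^2\le\sum_{i\in S_j}|\langle u,u_i\rangle|^2\le 16\|u\|^2\quad\text{for all }u\in\mathbb{H}.$$
   Context: A family $\{f_i\}_{i\in I}$ in a (finite or infinite dimensional) Hilbert space $\mathbb{H}$ is a frame with (lower and upper) frame bounds $0<A\le B<\infty$ if $A\|f\|^2\le\sum_{i\in I}|\langle f,f_i\rangle|^2\le B\|f\|^2$ for all $f\in\mathbb{H}$; it is $A$-tight if one can take $A=B$. *)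

(* Defs.v *)
From HB Require Import structures.
From mathcomp Require Import all_boot all_order all_algebra sesquilinear complex.
From mathcomp Require Import boolp classical_sets reals constructive_ereal.
From mathcomp Require Import topology normedtype esum.

Set Implicit Arguments.
Unset Strict Implicit.
Unset Printing Implicit Defensive.

Import Order.TTheory GRing.Theory Num.Theory.
Import numFieldNormedType.Exports.

Local Open Scope classical_set_scope.
Local Open Scope ring_scope.

(* R[i] with its canonical numFieldType structure, without the reverse coercion that R[i]
   alone would leave in the statements. *)
Notation complexField R :=
  (ComplexField.complex_complex__canonical__Num_NumField R) (only parsing).

(* A Hilbert space over K (K = R or K = R[i]) is a complete normed K-module H
   with a positive definite form dot (linear in its first argument and
   theta-semilinear in its second) that induces the norm of H; these
   definitions only depend on the data. *)
Definition induces_norm (K : numFieldType) (H : normedModType K)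
    (dot : H -> H -> K) : Prop :=
  forall u : H, `|u| ^+ 2 = dot u u.

(* Squared norms and moduli are elements of K that lie on the real line; the
   map re : K -> R (idfun for K = R, the real part for K = R[i]) only serves
   to read them in R, where the possibly uncountable sums are taken. *)
Definition is_frame (R : realType) (K : numFieldType) (re : K -> R)
    (H : normedModType K) (dot : H -> H -> K)
    (I : choiceType) (S : set I) (f : I -> H) (A B : R) : Prop :=
  0 < A /\ A <= B /\
  forall u : H,
    ((A * re (`|u| ^+ 2))%:E <= \esum_(i in S) (re (`|dot u (f i)| ^+ 2))%:E
       /\ \esum_(i in S) (re (`|dot u (f i)| ^+ 2))%:E
            <= (B * re (`|u| ^+ 2))%:E)%E.

Definition is_tight_frame (R : realType) (K : numFieldType) (re : K -> R)
    (H : normedModType K) (dot : H -> H -> K)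
    (I : choiceType) (S : set I) (f : I -> H) (A : R) : Prop :=
  is_frame re dot S f A A.

(* Blocks may be empty: for H = {0} the index set itself is empty. *)
Definition is_partition2 (I : Type) (S1 S2 : set I) : Prop :=
  S1 `|` S2 = [set: I] /\ S1 `&` S2 = set0.

(* Main.v *)
Require Import Defs.
From HB Require Import structures.
From mathcomp Require Import all_boot all_order all_algebra sesquilinear complex.
From mathcomp Require Import boolp classical_sets reals constructive_ereal.
From mathcomp Require Import topology normedtype esum.
From mathcomp Require Import cardinality fsbigop filter finmap ereal.
From mathcomp Require Import ring lra.

(** This is the Marcus-Spielman-Srivastava argument, carried out with multiaffine
functions instead of polynomials. For a finite subfamily with Gram matrix [G], rescaled
so that its diagonal is 1/4, let [g y = det (1 + diag y G)]. The function
[F (y, w) = g y * g w] is multiaffine, so [1 - d_i] is the translation by [- e_i], and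
putting the index [i] in the first or in the second block amounts to translating [F] by
[- e_(true, i)] or by [- e_(false, i)]. Averages of two such translates remain stable
(nonzero on the product of upper half planes), hence satisfy the Rayleigh inequality
[F * d_i d_j F <= d_i F * d_j F] at real points; this makes the barrier functions
[d_i F / F] nonincreasing, and convex enough that, starting from barriers at most 1/4 at
the origin, averaging over all indices costs a translation by 2/3 in every variable: the
averaged function is positive above (2/3, ..., 2/3). The averages are then undone one
index at a time, one of the two translates remaining positive above the base point.
The resulting positivity of determinants says that
[1 + sum_i (2/3 - [i in S]) v_i v_i^*] is positive, where [v_i = u_i / 2], and
[sum_i v_i v_i^* <= 9/2] gives the upper bound 16 on each block. The lower bound is
18 - 16, and infinite index sets are reached through an ultrafilter. *)

Set Implicit Arguments.
Unset Strict Implicit.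
Unset Printing Implicit Defensive.

Import Order.TTheory GRing.Theory Num.Theory.
Import numFieldNormedType.Exports.

Local Open Scope classical_set_scope.
Local Open Scope ring_scope.

(** * Multiaffine functions on orthants *)

Definition axis (K : zmodType) (J : finType) (j : J) (t : K) : {ffun J -> K} :=
  [ffun k => t *+ (k == j)].

(** On multiaffine functions the unit forward difference is exactly the partial derivative. *)
Definition pdiff (K : pzRingType) (J : finType) (j : J)
    (F : {ffun J -> K} -> K) (z : {ffun J -> K}) : K :=
  F (z + axis j 1) - F z.

Definition multiaffine (K : pzRingType) (J : finType)
    (F : {ffun J -> K} -> K) : Prop :=
  forall j z t, F (z + axis j t) = F z + t * pdiff j F z.

Definition avg_shift (K : unitRingType) (J : finType) (a b : J)
    (F : {ffun J -> K} -> K) (z : {ffun J -> K}) : K :=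
  2^-1 * (F (z - axis a 1) + F (z - axis b 1)).

Section Axis.
Variables (K : zmodType) (J : finType).
Implicit Types (j : J) (s t : K).

Lemma axisD j s t : axis j (s + t) = axis j s + axis j t.
Proof. by apply/ffunP => k; rewrite !ffunE mulrnDl. Qed.

Lemma axisN j t : axis j (- t) = - axis j t.
Proof. by apply/ffunP => k; rewrite !ffunE mulNrn. Qed.

Lemma axisE j t k : axis j t k = if k == j then t else 0.
Proof. by rewrite ffunE; case: eqP. Qed.

End Axis.

Section Multiaffine.
Variables (K : comUnitRingType) (J : finType) (F : {ffun J -> K} -> K).
Hypothesis affF : multiaffine F.
Implicit Types (i j : J) (z : {ffun J -> K}).

Lemma pdiffC i j z : pdiff i (pdiff j F) z = pdiff j (pdiff i F) z.
Proof. by rewrite /pdiff (addrAC z); ring. Qed.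

Lemma pdiff_multiaffine j : multiaffine (pdiff j F).
Proof.
by move=> k z t; rewrite {1}/pdiff addrAC !affF /pdiff (addrAC z); ring.
Qed.

Lemma pdiff_same j z : pdiff j (pdiff j F) z = 0.
Proof.
have := affF j z (1 + 1); rewrite axisD addrA /pdiff => ->.
by rewrite /pdiff; ring.
Qed.

Lemma avg_shiftE a b z : (2 : K) \is a GRing.unit ->
  avg_shift a b F z = F z - 2^-1 * (pdiff a F z + pdiff b F z).
Proof.
move=> u2; rewrite /avg_shift -!axisN !affF.
have h : 2^-1 * (F z + F z) = F z.
  by rewrite -[F z + F z]mulr2n -[F z *+ 2]mulr_natl mulKr.
by rewrite -[in RHS]h; ring.
Qed.

Lemma avg_shift_multiaffine a b : multiaffine (avg_shift a b F).
Proof.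
move=> k z t; rewrite /pdiff /avg_shift !(addrAC z _ (- _)) !affF /pdiff; ring.
Qed.

Lemma pdiff_avg_shift a b j z :
  pdiff j (avg_shift a b F) z = avg_shift a b (pdiff j F) z.
Proof. by rewrite /pdiff /avg_shift !(addrAC z _ (- _)); ring. Qed.

End Multiaffine.

Section Orthant.
Variables (R : realFieldType) (J : finType).
Implicit Types (f : {ffun J -> R} -> R) (x y z : {ffun J -> R}) (i j a b : J).

Definition above z x : Prop := forall k, z k <= x k.

Definition pos_above f z : Prop := forall x, above z x -> 0 < f x.

Definition rayleigh f : Prop :=
  forall i j z, i != j ->
    f z * pdiff i (pdiff j f) z <= pdiff i f z * pdiff j f z.

Lemma above_refl z : above z z. Proof. by []. Qed.

Lemma above_trans y x z : above x y -> above y z -> above x z.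
Proof. by move=> h1 h2 k; apply: le_trans (h1 k) (h2 k). Qed.

Lemma above_axis z j t : 0 <= t -> above z (z + axis j t).
Proof.
by move=> t0 k; rewrite !ffunE lerDl; case: eqP => //; rewrite mulr0n.
Qed.

Lemma pos_aboveW f x z : above x z -> pos_above f x -> pos_above f z.
Proof. by move=> h fp y /(above_trans h)/fp. Qed.

(** Raising one coordinate at a time reduces statements on an orthant to one variable, in which a
    multiaffine function is affine. *)
Lemma orthant_ind (P : {ffun J -> R} -> Prop) z :
  P z ->
  (forall x j t, above z x -> 0 <= t -> P x -> P (x + axis j t)) ->
  forall x, above z x -> P x.
Proof.
move=> Pz Pstep x zx.
have step (s : seq J) : P (z + \sum_(j <- s) axis j (x j - z j)) /\
    above z (z + \sum_(j <- s) axis j (x j - z j)).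
  elim: s => [|j s [IH1 IH2]]; first by rewrite big_nil addr0; split.
  rewrite big_cons addrCA addrC.
  have t0 : 0 <= x j - z j by rewrite subr_ge0.
  split; first exact: Pstep.
  exact: above_trans IH2 (above_axis _ _ t0).
have [] := step (index_enum J).
suff -> : z + \sum_j axis j (x j - z j) = x by [].
apply/ffunP => k; rewrite ffunE sum_ffunE (bigD1 k) //= big1 => [|j jk].
  by rewrite axisE eqxx addr0 addrC subrK.
by rewrite axisE eq_sym (negPf jk).
Qed.

Variable f : {ffun J -> R} -> R.
Hypothesis afff : multiaffine f.

(** Along an axis the function is affine, so a change of sign produces an explicit zero, at
    parameter [f x / - d]. *)
Lemma pos_above_nonzero z :
  0 < f z -> (forall x, above z x -> f x != 0) -> pos_above f z.
Proof.
move=> fz fn0; apply: orthant_ind => // x j t zx t0 fx.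
case: (ltrgtP (f (x + axis j t)) 0) => // [ft|/eqP]; last first.
  by rewrite (negPf (fn0 _ _)) //; apply: above_trans zx (above_axis _ _ t0).
set d := pdiff j f x.
have ftE : f (x + axis j t) = f x + t * d by rewrite afff.
have d0 : d < 0.
  rewrite ltNge; apply/negP => d0.
  by move: ft; rewrite ftE ltNge addr_ge0 ?mulr_ge0 // ltW.
have s0 : 0 <= f x / - d by rewrite divr_ge0 ?oppr_ge0 // ltW.
have /negP[] := fn0 _ (above_trans zx (above_axis x j s0)).
by rewrite afff -/d invrN mulrN mulNr divfK ?(lt_eqF d0) // subrr.
Qed.

Lemma pdiff_ge0 z j : (forall x, above z x -> 0 <= f x) -> 0 <= pdiff j f z.
Proof.
move=> fp; rewrite leNgt; apply/negP => d0.
have s0 : 0 <= f z / - pdiff j f z + 1.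
  by rewrite addr_ge0 // divr_ge0 ?fp ?oppr_ge0 // ltW.
have := fp _ (above_axis z j s0).
rewrite afff mulrDl mul1r invrN mulrN mulNr divfK ?(lt_eqF d0) //.
by rewrite addrA subrr add0r leNgt d0.
Qed.

Hypothesis rayf : rayleigh f.

(** The derivative of [d_i f / f] in direction [j] has numerator [f * d_i d_j f - d_i f * d_j f],
    which the Rayleigh inequality makes nonpositive. *)
Lemma barrier_antimono z x i : pos_above f z -> above z x ->
  pdiff i f x / f x <= pdiff i f z / f z.
Proof.
move=> fp; move: x; apply: orthant_ind => // x j t zx t0 IH.
have zx' := above_trans zx (above_axis x j t0).
apply: le_trans IH; rewrite ler_pdivrMr ?fp // mulrAC ler_pdivlMr ?fp //.
rewrite afff (pdiff_multiaffine afff).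
have [->|nij] := eqVneq i j.
  rewrite pdiff_same // mulr0 addr0 mulrDr lerDl.
  by rewrite mulrCA mulr_ge0 // -expr2 sqr_ge0.
have := rayf x nij; rewrite pdiffC // -subr_ge0 => /(mulr_ge0 t0); lra.
Qed.

Lemma avg_shift_realE a b z :
  avg_shift a b f z = f z - 2^-1 * (pdiff a f z + pdiff b f z).
Proof. by rewrite avg_shiftE // unitfE pnatr_eq0. Qed.

(** If [f x] were not positive, [f] would vanish at some [y] reached from [x] along axis [j], with
    positive slope there. The Rayleigh inequality at [y] then makes every partial derivative
    nonnegative, so the average cannot be positive at [y]. *)
Lemma pos_above_lower a b z j t : 0 <= t ->
  pos_above (avg_shift a b f) z -> pos_above f (z + axis j t) ->
  pos_above f z.
Proof.
move=> t0 avp fp x zx; rewrite ltNge; apply/negP => fx.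
have ft : 0 < f (x + axis j t).
  by apply: fp => k; rewrite !ffunE lerD2r.
move: (ft); rewrite afff; set d := pdiff j f x => ft'.
have td : 0 < t * d by lra.
have d0 : 0 < d.
  move: td; rewrite lt0r mulf_eq0 negb_or => /andP[/andP[tn0 dn0] td].
  have tp : 0 < t by rewrite lt0r tn0.
  by rewrite lt0r dn0 /= -(pmulr_rge0 _ tp).
have s0 : 0 <= - f x / d by rewrite divr_ge0 ?oppr_ge0 // ltW.
set y := x + axis j (- f x / d).
have fy : f y = 0 by rewrite afff divfK ?(gt_eqF d0) // addrN.
have dy : pdiff j f y = d by rewrite pdiff_multiaffine // pdiff_same // mulr0 addr0.
have dge0 i : 0 <= pdiff i f y.
  have [->|nij] := eqVneq i j; first by rewrite dy ltW.
  by have := rayf y nij; rewrite fy mul0r dy pmulr_lge0.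
have zy : above z y by apply: above_trans zx (above_axis x j s0).
have := avp _ zy; rewrite avg_shift_realE fy => h.
have := dge0 a; have := dge0 b; lra.
Qed.

(** Positivity is carried down from the maximum of [z] and [L] to [z] by [pos_above_lower]: the
    induction climbs from [z], but its predicate is the implication to [pos_above f z]. *)
Lemma pos_above_of_avg a b z L :
  pos_above (avg_shift a b f) z -> pos_above f L -> pos_above f z.
Proof.
move=> avp fL.
pose M : {ffun J -> R} := [ffun k => Num.max (z k) (L k)].
have zM : above z M by move=> k; rewrite ffunE le_max lexx.
have fM : pos_above f M.
  by apply: pos_aboveW fL => k; rewrite ffunE le_max lexx orbT.
suff: pos_above f M -> pos_above f z by apply.
move: M zM {fM}; apply: orthant_ind => // x j t zx t0 IH fx; apply: IH.
exact: pos_above_lower t0 (pos_aboveW zx avp) fx.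
Qed.

(** A barrier below 1 means [d_j f < f], that is, a positive value one unit lower on axis [j];
    antimonotonicity extends the bound from [z] to its whole orthant. *)
Lemma pos_above_shift j z : pos_above f z ->
  pdiff j f z / f z < 1 -> pos_above f (z - axis j 1).
Proof.
move=> fp bz x zx.
have zx' : above z (x + axis j 1).
  by move=> k; have := zx k; rewrite !ffunE lerBlDr.
have := barrier_antimono j fp zx'; move/le_lt_trans/(_ bz).
have fx' := fp _ zx'.
rewrite ltr_pdivrMr // mul1r.
by rewrite (pdiff_multiaffine afff) pdiff_same // mulr0 addr0 /pdiff ltrBlDl ltrDr.
Qed.

(** Positivity of the average at [z] says that the two barriers have mean below 1, so one of them is
    below 1. *)
Lemma greedy_choice a b z L :
  pos_above (avg_shift a b f) z -> pos_above f L ->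
  pos_above f (z - axis a 1) \/ pos_above f (z - axis b 1).
Proof.
move=> avp fL; have fp := pos_above_of_avg avp fL.
have := avp _ (above_refl z); rewrite avg_shift_realE.
have f0 := fp _ (above_refl z).
case: (ltrP (pdiff a f z / f z) 1) => ha; first by left; apply: pos_above_shift.
case: (ltrP (pdiff b f z / f z) 1) => hb; first by right; apply: pos_above_shift.
move: ha hb; rewrite !ler_pdivlMr // !mul1r; lra.
Qed.

End Orthant.

(** * Barrier functions under averaging of two shifts *)

Section Barrier.
Variables (R : realFieldType) (J : finType).
Implicit Types (f : {ffun J -> R} -> R) (x y z : {ffun J -> R}) (i j a b : J).

(* [N / D] is the barrier function along a line; the Wronskian hypothesis says that
   it is nonincreasing, and nonnegativity of the Wronskian, a quadratic in [u],
   upgrades this to the convexity estimate needed. *)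
Lemma convexity_quadratic (N0 N1 N2 D0 D1 D2 : R) :
  0 < D0 -> D1 <= D0 / 2 -> 0 <= D1 -> 0 <= D2 -> 4 * D0 * D2 <= D1 ^+ 2 ->
  (forall u, 0 <= (N0 + u * N1 + u ^+ 2 * N2) * (D1 + 2 * u * D2)
                  - (D0 + u * D1 + u ^+ 2 * D2) * (N1 + 2 * u * N2)) ->
  (N0 - N1 / 2) * (D0 + (- (2 / 3)) * D1 + (- (2 / 3)) ^+ 2 * D2)
    <= (N0 + (- (2 / 3)) * N1 + (- (2 / 3)) ^+ 2 * N2) * (D0 - D1 / 2).
Proof.
move=> D0p D1le D1ge D2ge disc W.
(* [W0], [W1], [W2] are the coefficients of the Wronskian as a polynomial in [u]; the claim turns
   out to be linear in them. *)
set W0 := N0 * D1 - N1 * D0; set W1 := 2 * (N0 * D2 - N2 * D0).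
set W2 := N1 * D2 - N2 * D1.
have WE u : 0 <= W0 + u * W1 + u ^+ 2 * W2.
  by have := W u; rewrite /W0 /W1 /W2; congr (0 <= _); ring.
have W2E : D0 * W2 = D1 * W1 / 2 - D2 * W0 by rewrite /W0 /W1 /W2; field.
have W0ge : 0 <= W0 by have := WE 0; lra.
rewrite -subr_ge0.
set E := (X in 0 <= X).
have -> : E = W0 / 6 - W1 * 2 / 9 + W2 * 2 / 9 by rewrite /E /W0 /W1 /W2; field.
rewrite -(pmulr_rge0 _ D0p).
have -> : D0 * (W0 / 6 - W1 * 2 / 9 + W2 * 2 / 9)
  = W0 * (D0 / 6 - D2 * 2 / 9) - (2 / 9) * (W1 * (D0 - D1 / 2)).
  have -> : D0 * (W0 / 6 - W1 * 2 / 9 + W2 * 2 / 9)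
    = D0 * (W0 / 6 - W1 * 2 / 9) + (D0 * W2) * 2 / 9 by field.
  by rewrite W2E; field.
have c0 : 0 <= D0 - D1 / 2 by lra.
have D2le : D2 <= D0 / 16.
  rewrite -(ler_pM2l D0p).
  have : D1 ^+ 2 <= (D0 / 2) ^+ 2 by rewrite ler_sqr ?nnegrE //; lra.
  lra.
have [W1le|W1gt] := lerP W1 0.
  have h1 : 0 <= W0 * (D0 / 6 - D2 * 2 / 9) by rewrite mulr_ge0 //; lra.
  have h2 : W1 * (D0 - D1 / 2) <= 0 by rewrite mulr_le0_ge0.
  lra.
have W0gt : 0 < W0.
  rewrite lt0r W0ge andbT; apply/eqP => W00.
  have := mulr_ge0 (ltW D0p) (WE (-1)).
  have -> : D0 * (W0 + -1 * W1 + (-1) ^+ 2 * W2) = D0 * W0 - D0 * W1 + D0 * W2.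
    by ring.
  rewrite W2E W00.
  have : 0 < W1 * (D0 - D1 / 2) by rewrite mulr_gt0 //; lra.
  lra.
have W1n0 : W1 != 0 by rewrite gt_eqF.
(* Evaluation at [- (2 * W0 / W1)] gives the discriminant bound without dividing by [W2]. *)
have dW : W1 ^+ 2 <= 4 * W0 * W2.
  have := WE (- (2 * W0 / W1)).
  have -> : W0 + - (2 * W0 / W1) * W1 + (- (2 * W0 / W1)) ^+ 2 * W2
     = W0 * ((4 * W0 * W2 - W1 ^+ 2) / W1 ^+ 2) by field.
  by rewrite pmulr_rge0 // pmulr_lge0 ?invr_gt0 ?exprn_gt0 // subr_ge0.
have dW' : D0 * W1 ^+ 2 <= 4 * W0 * (D1 * W1 / 2 - D2 * W0).
  by rewrite -W2E [leRHS]mulrCA ler_pM2l.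
have W1leW0 : W1 <= W0.
  rewrite -(ler_pM2l D0p) -(ler_pM2r W1gt).
  have h1 : 0 <= D2 * W0 ^+ 2 by rewrite mulr_ge0 // sqr_ge0.
  have h2 : 0 <= (D0 - 2 * D1) * (W0 * W1).
    by apply: mulr_ge0; [lra | rewrite mulr_ge0 // ltW].
  lra.
rewrite -(pmulr_rge0 _ W0gt).
(* By [dW'], the quantity left to bound is at least [1 / 18] of this product. *)
have : 0 <= D0 * ((3 * W0 - W1) * (W0 - W1)).
  by rewrite !mulr_ge0 ?subr_ge0 ?(ltW D0p) //; lra.
lra.
Qed.

Lemma line_expansion f a b z u : multiaffine f ->
  f (z + axis a u + axis b u) =
  f z + u * (pdiff a f z + pdiff b f z) + u ^+ 2 * pdiff a (pdiff b f) z.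
Proof.
by move=> af; rewrite !af (pdiff_multiaffine af); ring.
Qed.

Variables (f : {ffun J -> R} -> R) (a b : J) (z : {ffun J -> R}).
Hypotheses (afff : multiaffine f) (rayf : rayleigh f) (fp : pos_above f z).
Hypotheses (ab : a != b) (Ba : pdiff a f z / f z <= 1 / 4)
  (Bb : pdiff b f z / f z <= 1 / 4).

Lemma avg_shift_barrier_bound x : above z x ->
  pdiff a f x + pdiff b f x <= f x / 2.
Proof.
move=> zx; have fx := fp zx.
have := le_trans (barrier_antimono afff rayf a fp zx) Ba.
have := le_trans (barrier_antimono afff rayf b fp zx) Bb.
rewrite !ler_pdivrMr //; lra.
Qed.

Lemma pos_above_avg_shift : pos_above (avg_shift a b f) z.
Proof.
move=> x zx; rewrite avg_shift_realE //.
have := avg_shift_barrier_bound zx; have := fp zx; lra.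
Qed.

(** Along the diagonal direction of the coordinates [a] and [b], both [f] and [d_j f] are quadratic
    polynomials. With base point [z'], [convexity_quadratic] compares the new barrier there with the
    old one at [z], which has parameter [- (2 / 3)]. *)
Lemma barrier_avg_shift j z' : j != a -> j != b ->
  z' = z + axis a (2 / 3) + axis b (2 / 3) ->
  pdiff j (avg_shift a b f) z' / avg_shift a b f z' <= pdiff j f z / f z.
Proof.
move=> ja jb z'E.
have d0 : 0 <= 2 / 3 :> R by lra.
have zz' : above z z'.
  rewrite z'E; exact: above_trans (above_axis z a d0) (above_axis _ b d0).
rewrite pdiff_avg_shift.
have Np := pos_above_avg_shift zz'; have D0p := fp zz'.
rewrite ler_pdivrMr // mulrAC ler_pdivlMr ?fp //.
have ez : z = z' + axis a (- (2 / 3)) + axis b (- (2 / 3)).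
  by rewrite z'E !axisN addrAC addrK addrK.
have afj := pdiff_multiaffine afff j.
rewrite [in f z]ez [in pdiff j f z]ez !line_expansion // !avg_shift_realE //.
have fp' : pos_above f z' by apply: pos_aboveW fp.
have := @convexity_quadratic (pdiff j f z')
  (pdiff a (pdiff j f) z' + pdiff b (pdiff j f) z')
  (pdiff a (pdiff b (pdiff j f)) z') (f z') (pdiff a f z' + pdiff b f z')
  (pdiff a (pdiff b f) z') D0p.
rewrite !(mulrC 2^-1); apply.
- exact: avg_shift_barrier_bound.
- by rewrite addr_ge0 // pdiff_ge0 // => x /fp'/ltW.
- apply: pdiff_ge0 => [|x zx]; first exact: pdiff_multiaffine.
  by apply: pdiff_ge0 => // y /(above_trans zx)/fp'/ltW.
- have := rayf z' ab; have := sqr_ge0 (pdiff a f z' - pdiff b f z'); lra.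
(* The Wronskian is the sum of the Rayleigh differences for the pairs [(j, a)] and [(j, b)] at the
   point of parameter [u]. *)
move=> u; set x := z' + axis a u + axis b u.
have Px g : multiaffine g -> g x = g z' + u * (pdiff a g z' + pdiff b g z')
    + u ^+ 2 * pdiff a (pdiff b g) z' by move=> ag; rewrite line_expansion.
have dax g : multiaffine g -> pdiff a g x = pdiff a g z' + u * pdiff a (pdiff b g) z'.
  move=> ag; rewrite Px; last exact: pdiff_multiaffine.
  rewrite pdiff_same // (pdiffC g b a) (pdiffC (pdiff a g) a b) [X in _ + _ * X]/pdiff.
  by rewrite !pdiff_same // subrr mulr0 addr0 add0r.
have dbx g : multiaffine g -> pdiff b g x = pdiff b g z' + u * pdiff a (pdiff b g) z'.
  move=> ag; rewrite Px; last exact: pdiff_multiaffine.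
  by rewrite !pdiff_same // [X in _ + _ * X]/pdiff !pdiff_same // subrr mulr0 !addr0.
have := rayf x ja; have := rayf x jb.
rewrite (pdiffC f j a) (pdiffC f j b) !dax // !dbx // !Px //; lra.
Qed.

End Barrier.

(** * Stability *)

Section Stable.
Variables (R : rcfType) (J : finType).
Local Notation C := (complex R).
Local Notation Re := (@complex.Re R).
Local Notation Im := (@complex.Im R).
Implicit Types (f : {ffun J -> R} -> R) (F : {ffun J -> C} -> C).

Definition stable F : Prop :=
  forall z : {ffun J -> C}, (forall k, 0 < Im (z k)) -> F z != 0.

Definition complex_pt (x : {ffun J -> R}) : {ffun J -> C} :=
  [ffun k => ((x k)%:C)%C].

Definition real_restriction f F : Prop :=
  forall x, F (complex_pt x) = ((f x)%:C)%C.

(** This is the imaginary part of [u] times the conjugate of [v]: it has the sign of that of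
    [u / v], but is a polynomial. *)
Definition im_ratio (u v : C) : R := Im u * Re v - Re u * Im v.

Lemma im_div_lt0 (u v : C) : u != 0 -> 0 <= im_ratio u v -> 0 <= Im (- v / u).
Proof.
case: u v => [a b] [c d]; rewrite /im_ratio eq_complex /= => ab0 h.
have n0 : 0 < a ^+ 2 + b ^+ 2.
  rewrite lt0r addr_ge0 ?sqr_ge0 // andbT paddr_eq0 ?sqr_ge0 //.
  by rewrite !sqrf_eq0.
have -> : - c * (- (b / (a ^+ 2 + b ^+ 2))) + - d * (a / (a ^+ 2 + b ^+ 2))
   = (b * c - a * d) / (a ^+ 2 + b ^+ 2) by field; rewrite gt_eqF.
by rewrite divr_ge0 // ltW.
Qed.

(** [F] vanishes at [z + axis j s] for [s = - F z / pdiff j F z], so stability keeps [s] out of the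
    closed upper half plane. *)
Lemma stable_im_lt0 F j (z : {ffun J -> C}) : multiaffine F -> stable F ->
  (forall k, 0 < Im (z k)) -> pdiff j F z != 0 ->
  im_ratio (pdiff j F z) (F z) < 0.
Proof.
move=> aF sF zp D0; rewrite ltNge; apply/negP => /(im_div_lt0 D0) s0.
set s := - F z / pdiff j F z in s0.
have /sF : forall k, 0 < Im ((z + axis j s) k).
  move=> k; rewrite !ffunE raddfD /= ltr_wpDr //.
  by case: eqP => _; rewrite ?mulr1n ?mulr0n.
by rewrite aF divfK // addrN eqxx.
Qed.

Lemma stable_im_le0 F j (z : {ffun J -> C}) : multiaffine F -> stable F ->
  (forall k, 0 < Im (z k)) -> im_ratio (pdiff j F z) (F z) <= 0.
Proof.
move=> aF sF zp; have [->|D0] := eqVneq (pdiff j F z) 0.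
  by rewrite /im_ratio /= !mul0r subrr.
exact/ltW/stable_im_lt0.
Qed.

Lemma quadratic_le0 (a b c : R) :
  (forall t, 0 < t -> a + t * b + t ^+ 2 * c <= 0) -> a <= 0.
Proof.
move=> h; rewrite leNgt; apply/negP => a0.
set M := `|b| + `|c| + a; have M0 : 0 < M by rewrite ltr_wpDl // addr_ge0.
(* With this [t] the terms in [b] and [c] together stay below [a / 2] in absolute value. *)
set t := a / (2 * M).
have t0 : 0 < t by rewrite divr_gt0 // mulr_gt0.
have tM : t * M = a / 2 by rewrite /t; field; rewrite gt_eqF.
have t1 : t < 1.
  rewrite ltr_pdivrMr ?mulr_gt0 // mul1r /M.
  have := normr_ge0 b; have := normr_ge0 c; lra.
have := h _ t0.
have hb : - (t * `|b|) <= t * b.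
  by rewrite -mulrN ler_pM2l //; have := ler_norm (- b); rewrite normrN; lra.
have hc : - (t * `|c|) <= t ^+ 2 * c.
  have h1 : - (t ^+ 2 * `|c|) <= t ^+ 2 * c.
    rewrite -mulrN ler_pM2l ?exprn_gt0 //.
    by have := ler_norm (- c); rewrite normrN; lra.
  have h2 : t ^+ 2 * `|c| <= t * `|c|.
    by apply: ler_wpM2r => //; rewrite expr2 ger_pMr // ltW.
  lra.
have : t * M = t * `|b| + t * `|c| + t * a by rewrite /M; ring.
have : 0 < t * a by rewrite mulr_gt0.
lra.
Qed.

(* Passing to the boundary one coordinate at a time, where [im_ratio] is a
   quadratic polynomial of the perturbation. *)
Lemma stable_im_boundary F j (z : {ffun J -> C}) : multiaffine F -> stable F ->
  (forall k, 0 <= Im (z k)) -> im_ratio (pdiff j F z) (F z) <= 0.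
Proof.
move=> aF sF.
have step (s : seq J) : forall z : {ffun J -> C}, (forall k, 0 <= Im (z k)) ->
    (forall k, k \notin s -> 0 < Im (z k)) ->
    im_ratio (pdiff j F z) (F z) <= 0.
  elim: s => [|i s IH] {}z z0 zs; first by apply: stable_im_le0 => // k; exact: zs.
  set D' := pdiff i (pdiff j F) z; set F' := pdiff i F z.
  set D := pdiff j F z; set F0 := F z.
  apply: (@quadratic_le0 _
    (Re D' * Re F0 - Im D * Im F' + Im D' * Im F0 - Re D * Re F')
    (Re D' * (- Im F') + Im D' * Re F')) => t t0.
  have := IH (z + axis i ((0 +i* t)%C)).
  have e k : Im ((z + axis i ((0 +i* t)%C)) k) = Im (z k) + t *+ (k == i).
    by rewrite !ffunE raddfD /=; case: (k == i); rewrite ?mulr1n ?mulr0n.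
  have h1 : forall k, 0 <= Im ((z + axis i ((0 +i* t)%C)) k).
    by move=> k; rewrite e addr_ge0 // mulrn_wge0 // ltW.
  move=> /(_ h1); have h2 : forall k, k \notin s ->
      0 < Im ((z + axis i ((0 +i* t)%C)) k).
    move=> k ks; rewrite e; have [->|ki] := eqVneq k i.
      by rewrite mulr1n ltr_wpDl.
    by rewrite mulr0n addr0 zs // inE negb_or ki.
  move=> /(_ h2); rewrite aF (pdiff_multiaffine aF) -/D -/F0 -/D' -/F'.
  case: D D' F0 F' => [a b] [a' b'] [c d] [c' d']; rewrite /im_ratio /=.
  by congr (_ <= 0); ring.
by move=> z0; apply: (step (enum J)) => // k; rewrite mem_enum.
Qed.

Lemma complex_ptD x y : complex_pt (x + y) = complex_pt x + complex_pt y.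
Proof. by apply/ffunP => k; rewrite !ffunE rmorphD. Qed.

Lemma complex_pt_axis j t : complex_pt (axis j t) = axis j (t%:C)%C.
Proof. by apply/ffunP => k; rewrite !ffunE rmorphMn. Qed.

Lemma real_restriction_pdiff f F j : real_restriction f F ->
  real_restriction (pdiff j f) (pdiff j F).
Proof.
by move=> fF x; rewrite /pdiff -[1]/(1%:C)%C -complex_pt_axis -complex_ptD !fF rmorphB.
Qed.

Lemma real_restriction_multiaffine f F : real_restriction f F ->
  multiaffine F -> multiaffine f.
Proof.
move=> fF aF j z t; apply: (@complexI R).
rewrite -fF complex_ptD complex_pt_axis aF rmorphD rmorphM /=.
by rewrite fF (real_restriction_pdiff _ fF).
Qed.

(** At the real point [z] shifted by the imaginary unit in coordinate [i], the [im_ratio] of [d_j F]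
    and [F] is exactly [f * d_i d_j f - d_i f * d_j f]. *)
Lemma stable_rayleigh f F : real_restriction f F -> multiaffine F -> stable F ->
  rayleigh f.
Proof.
move=> fF aF sF i j z ij.
have := @stable_im_boundary F j (complex_pt z + axis i (0 +i* 1)%C) aF sF.
have h0 : forall k, 0 <= Im ((complex_pt z + axis i (0 +i* 1)%C) k).
  move=> k; rewrite !ffunE raddfD /= add0r.
  by case: eqP => _; rewrite ?mulr1n ?mulr0n.
move=> /(_ h0); rewrite aF (pdiff_multiaffine aF).
have hj := real_restriction_pdiff j fF.
rewrite (real_restriction_pdiff i hj) hj (real_restriction_pdiff i fF) fF.
rewrite /im_ratio /=; lra.
Qed.

(** At a zero, [d_a F + d_b F = 2 F], whose [im_ratio] with [F] is 0. Both summands are nonpositive,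
    so both vanish; by strictness both derivatives vanish, and then so does [F]. *)
Lemma stable_avg_shift F a b : multiaffine F -> stable F ->
  stable (avg_shift a b F).
Proof.
move=> aF sF z zp; rewrite avg_shiftE // ?unitfE ?pnatr_eq0 //.
apply/eqP => h.
have Ha := stable_im_le0 a aF sF zp; have Hb := stable_im_le0 b aF sF zp.
have two : (2 : C) != 0 by rewrite pnatr_eq0.
have {}h : pdiff a F z + pdiff b F z = F z + F z.
  move/eqP: h; rewrite subr_eq0 => /eqP ->.
  by rewrite -[RHS]mulr2n -[RHS]mulr_natl mulVKf.
have sum0 : im_ratio (pdiff a F z) (F z) + im_ratio (pdiff b F z) (F z) = 0.
  have -> : im_ratio (pdiff a F z) (F z) + im_ratio (pdiff b F z) (F z)
     = im_ratio (pdiff a F z + pdiff b F z) (F z).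
    by rewrite /im_ratio !raddfD /=; ring.
  by rewrite h /im_ratio !raddfD /=; ring.
have d0 i : im_ratio (pdiff i F z) (F z) = 0 -> pdiff i F z = 0.
  move=> e; apply/eqP/negPn/negP => /(stable_im_lt0 aF sF zp).
  by rewrite e ltxx.
have := sF z zp.
have Da : pdiff a F z = 0 by apply: d0; lra.
have Db : pdiff b F z = 0 by apply: d0; lra.
have Fz : F z + F z = 0 by rewrite -h Da Db addr0.
by rewrite -(mulrI_eq0 _ (mulfI two)) mulr_natl mulr2n Fz eqxx.
Qed.

Lemma real_restriction_avg_shift f F a b : real_restriction f F ->
  real_restriction (avg_shift a b f) (avg_shift a b F).
Proof.
move=> fF x; rewrite /avg_shift.
have e j : complex_pt x - axis j 1 = complex_pt (x - axis j 1).
  by rewrite -!axisN complex_ptD complex_pt_axis rmorphN.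
by rewrite !e !fF -rmorphD rmorphM /= fmorphV rmorph_nat.
Qed.

End Stable.

(** * Choosing a block for every index *)

Section Selection.
Variables (R : rcfType) (I : finType).
Local Notation C := (complex R).
Local Notation J := (bool * I)%type.
Implicit Types (f : {ffun J -> R} -> R) (F : {ffun J -> C} -> C).

Definition avg_all (K : unitRingType) (s : seq I) (F : {ffun J -> K} -> K) :=
  foldr (fun i G => avg_shift (true, i) (false, i) G) F s.

Variables (f : {ffun J -> R} -> R) (F : {ffun J -> C} -> C).
Hypotheses (fF : real_restriction f F) (aF : multiaffine F) (sF : stable F).

Lemma avg_all_class s :
  [/\ real_restriction (avg_all s f) (avg_all s F),
      multiaffine (avg_all s F) & stable (avg_all s F)].
Proof.
elim: s => [|i s [IH1 IH2 IH3]] //=; split.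
- exact: real_restriction_avg_shift.
- exact: avg_shift_multiaffine.
- exact: stable_avg_shift.
Qed.

Lemma avg_all_real s : multiaffine (avg_all s f) /\ rayleigh (avg_all s f).
Proof.
have [h1 h2 h3] := avg_all_class s.
split; first exact: real_restriction_multiaffine h1 h2.
exact: stable_rayleigh h1 h2 h3.
Qed.

Hypothesis fp : pos_above f 0.

(** A crude bound, one unit per averaging; it supplies the starting orthant that [greedy_choice]
    asks for. *)
Lemma avg_all_pos s : exists L, pos_above (avg_all s f) L.
Proof.
elim: s => [|i s [L IH]]; first by exists 0.
exists [ffun k => L k + 1] => x Lx /=; rewrite /avg_shift mulr_gt0 ?invr_gt0 //.
have h j : 0 < avg_all s f (x - axis j 1).
  apply: IH => k; have := Lx k; rewrite !ffunE lerBrDr; apply: le_trans.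
  by rewrite lerD2l; case: eqP => _; rewrite ?mulr0n ?ler01.
by rewrite addr_gt0.
Qed.

Hypothesis f0 : forall k, pdiff k f 0 / f 0 <= 1 / 4.

Lemma avg_all_barrier s : uniq s ->
  let z := [ffun k : J => if k.2 \in s then 2 / 3 else 0] in
  pos_above (avg_all s f) z /\
  forall k, k.2 \notin s -> pdiff k (avg_all s f) z / avg_all s f z <= 1 / 4.
Proof.
elim: s => [|i s IH] /=.
  have -> : [ffun k : J => if k.2 \in [::] then 2 / 3 else 0] = 0 :> {ffun J -> R}.
    by apply/ffunP => k; rewrite !ffunE.
  by split.
case/andP => nis us; have [p B] := IH us.
set z := [ffun k : J => _] in p B; set z' := [ffun k : J => _].
have zE : z' = z + axis (true, i) (2 / 3) + axis (false, i) (2 / 3).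
  apply/ffunP => -[b j]; rewrite !ffunE /= inE !xpair_eqE.
  have [->|ji] := eqVneq j i; rewrite ?(negPf nis) ?andbT ?andbF /=.
    by case: b; rewrite !mulr1n mulr0n ?addr0 ?add0r.
  by rewrite mulr0n !addr0.
have zz' : above z z'.
  move=> [b j]; rewrite !ffunE /= inE.
  by have [->|ji] := eqVneq j i; rewrite ?(negPf nis) //=; lra.
have [af rf] := avg_all_real s.
have tf : (true, i) != (false, i) by [].
have Bt := B (true, i) nis; have Bf := B (false, i) nis.
split; first exact: pos_aboveW zz' (pos_above_avg_shift af rf p Bt Bf).
move=> k; rewrite inE negb_or => /andP[ki ks].
apply: le_trans (B k ks).
by apply: barrier_avg_shift => //; apply: contraNneq ki => ->.
Qed.

(** The averages are undone from the outermost one; each choice lowers the base point by 1 in the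
    coordinate it selects, and [c] records it. *)
Lemma avg_all_greedy s z : uniq s -> pos_above (avg_all s f) z ->
  exists c : I -> bool,
    pos_above f [ffun k => z k - ((k.2 \in s) && (k.1 == c k.2))%:R].
Proof.
elim: s z => [|i s IH] z /=.
  move=> _ h; exists (fun=> true).
  suff -> : [ffun k => z k - ((k.2 \in [::]) && (k.1 == true))%:R] = z by [].
  by apply/ffunP => k; rewrite ffunE subr0.
case/andP => nis us h; have [af rf] := avg_all_real s.
have [L pL] := avg_all_pos s.
have [b /(IH _ us)[c hc]] : exists b, pos_above (avg_all s f) (z - axis (b, i) 1).
  by case: (greedy_choice af rf h pL) => ?; [exists true | exists false].
exists (fun j => if j == i then b else c j); move: hc; congr pos_above.
apply/ffunP => -[b' j]; rewrite !ffunE /= inE xpair_eqE.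
have [->|ji] := eqVneq j i; rewrite ?(negPf nis) ?andbT ?andbF /= ?subr0 //.
Qed.

Lemma exists_selection : exists c : I -> bool,
  pos_above f [ffun k => 2 / 3 - (k.1 == c k.2)%:R].
Proof.
have [p _] := avg_all_barrier (enum_uniq I).
have [c hc] := avg_all_greedy (enum_uniq I) p.
exists c; move: hc; congr pos_above.
by apply/ffunP => k; rewrite !ffunE mem_enum.
Qed.

End Selection.

(** * Gram matrices *)

(** Sylvester's identity: the block matrix [M] has two factorizations into block triangular
    matrices. *)
Lemma det_1addmulmx (R : comPzRingType) (m n : nat)
    (A : 'M[R]_(m, n)) (B : 'M[R]_(n, m)) :
  \det (1%:M + A *m B) = \det (1%:M + B *m A).
Proof.
pose M := block_mx 1%:M (- A) B 1%:M : 'M[R]_(m + n).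
have e1 : M = block_mx 1%:M 0 B 1%:M *m block_mx 1%:M (- A) 0 (1%:M + B *m A).
  rewrite mulmx_block !mul1mx !mul0mx !mulmx1 !addr0 mulmxN.
  by rewrite addrCA addNr addr0.
have e2 : M = block_mx (1%:M + A *m B) (- A) 0 1%:M *m block_mx 1%:M 0 B 1%:M.
  rewrite mulmx_block !mul1mx !mulmx1 !mulmx0 !add0r mulNmx.
  by rewrite addrK.
have := congr1 determinant e1; rewrite e2 !det_mulmx !det_lblock !det_ublock.
by rewrite !det1 !mul1r !mulr1.
Qed.

Section Gram.
Variables (R : rcfType) (n : nat).
Local Notation C := (complex R).
Local Notation Re := (@complex.Re R).
Local Notation Im := (@complex.Im R).
Variable G : 'M[C]_n.

Definition nsq (x : C) : R := Re x ^+ 2 + Im x ^+ 2.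

Definition ip (a b : 'cV[C]_n) : C := \sum_k (((a k 0)^*)%C * b k 0).

Definition pencil (y : {ffun 'I_n -> C}) : 'M[C]_n :=
  1%:M + diag_mx (\row_i y i) *m G.

Definition gdet y := \det (pencil y).

Definition gdetR (y : {ffun 'I_n -> R}) : R := Re (gdet (complex_pt y)).

Hypothesis hermG : forall i j, ((G i j)^*)%C = G j i.
Hypothesis diagG : forall i, G i i = ((1 / 4)%:C)%C.
Hypothesis boundG : forall c : 'cV_n,
  \sum_i nsq ((G *m c) i 0) <= 9 / 2 * Re (ip c (G *m c)).

Lemma nsq_ge0 x : 0 <= nsq x.
Proof. by rewrite addr_ge0 ?sqr_ge0. Qed.

Lemma nsq_eq0 x : nsq x = 0 -> x = 0.
Proof.
move/eqP; rewrite paddr_eq0 ?sqr_ge0 // !sqrf_eq0 => /andP[/eqP a /eqP b].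
by case: x a b => a b /= -> ->.
Qed.

Lemma cReM (x y : C) : Re (x * y) = Re x * Re y - Im x * Im y.
Proof. by case: x y => [a b] [c d]. Qed.

Lemma cImM (x y : C) : Im (x * y) = Re x * Im y + Im x * Re y.
Proof. by case: x y => [a b] [c d]. Qed.

Lemma cReConj (x : C) : Re ((x^*)%C) = Re x. Proof. by case: x. Qed.
Lemma cImConj (x : C) : Im ((x^*)%C) = - Im x. Proof. by case: x. Qed.

Lemma cReD (x y : C) : Re (x + y) = Re x + Re y. Proof. by case: x; case: y. Qed.
Lemma cReN (x : C) : Re (- x) = - Re x. Proof. by case: x. Qed.
Lemma cImN (x : C) : Im (- x) = - Im x. Proof. by case: x. Qed.

Lemma cRe_sum (I : Type) (s : seq I) (P : pred I) (F : I -> C) :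
  Re (\sum_(i <- s | P i) F i) = \sum_(i <- s | P i) Re (F i).
Proof. exact: (raddf_sum (@complex.Re R : Rcomplex R -> R)). Qed.

Lemma cIm_sum (I : Type) (s : seq I) (P : pred I) (F : I -> C) :
  Im (\sum_(i <- s | P i) F i) = \sum_(i <- s | P i) Im (F i).
Proof. exact: (raddf_sum (@complex.Im R : Rcomplex R -> R)). Qed.

Lemma pencilE y (c : 'cV_n) i :
  (pencil y *m c) i 0 = c i 0 + y i * (G *m c) i 0.
Proof. by rewrite mulmxDl mul1mx -mulmxA mul_diag_mx !mxE. Qed.

Lemma gdet_multiaffine : multiaffine gdet.
Proof.
move=> j z t.
suff -> : gdet (z + axis j t) = (1 - t) * gdet z + t * gdet (z + axis j 1).
  by rewrite /pdiff; move: (gdet z) (gdet _) => a b; ring.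
apply: (@determinant_multilinear _ _ _ _ _ j).
- rewrite /pencil !mul_diag_mx; apply/rowP => k.
  by rewrite !mxE !ffunE eqxx !mulr1n; ring.
- rewrite /pencil !mul_diag_mx; apply/matrixP => i k.
  have ne : (lift j i == j) = false by rewrite eq_sym; exact: negPf (neq_lift _ _).
  rewrite !mxE !ffunE ne.
  by rewrite !mulr0n addr0.
- rewrite /pencil !mul_diag_mx; apply/matrixP => i k.
  have ne : (lift j i == j) = false by rewrite eq_sym; exact: negPf (neq_lift _ _).
  rewrite !mxE !ffunE ne.
  by rewrite !mulr0n !addr0.
Qed.

Lemma ip_selfadjoint a b : ip (G *m a) b = ip a (G *m b).
Proof.
rewrite /ip.
under eq_bigr => k _ do rewrite mxE rmorph_sum mulr_suml.
under [RHS]eq_bigr => k _ do rewrite mxE mulr_sumr.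
rewrite exchange_big; apply: eq_bigr => i _; apply: eq_bigr => k _.
by rewrite rmorphM /= hermG; ring.
Qed.

Lemma ipC a b : ((ip a b)^*)%C = ip b a.
Proof.
by rewrite /ip rmorph_sum; apply: eq_bigr => k _; rewrite rmorphM /= conjcK mulrC.
Qed.

Lemma ip_G_real c : Im (ip c (G *m c)) = 0.
Proof.
have := ipC c (G *m c); rewrite ip_selfadjoint => /(congr1 Im).
rewrite cImConj; lra.
Qed.

Lemma ip_G_ge0 c : 0 <= Re (ip c (G *m c)).
Proof.
have := boundG c; have : 0 <= \sum_i nsq ((G *m c) i 0).
  by apply: sumr_ge0 => i _; apply: nsq_ge0.
lra.
Qed.

(** A kernel vector satisfies [c = - Y G c], with [Y] the diagonal matrix of [y]. Pairing it with
    [G c] gives the formula, and [G c = 0] would force [c = 0]. *)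
Lemma gdet_eq0_kernel y : gdet y = 0 ->
  exists2 c : 'cV_n, G *m c != 0 &
    ip c (G *m c) = - \sum_i ((((y i)^*)%C) * ((nsq ((G *m c) i 0))%:C)%C).
Proof.
rewrite /gdet -det_tr => /eqP/det0P[v v0 hv].
have hc i : v^T i 0 = - (y i * (G *m v^T) i 0).
  have : pencil y *m v^T = 0 by rewrite -[pencil y]trmxK -trmx_mul hv trmx0.
  move=> /(congr1 (fun M : 'cV_n => M i 0)); rewrite pencilE [RHS]mxE => /eqP.
  by rewrite addr_eq0 => /eqP.
exists v^T.
  apply: contraNneq v0 => Gv; rewrite -(inj_eq trmx_inj); apply/eqP/colP => i.
  by rewrite hc Gv !mxE mulr0 oppr0.
rewrite /ip -sumrN; apply: eq_bigr => i _.
rewrite [in LHS]hc rmorphN rmorphM mulNr -mulrA; congr (- (_ * _)).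
case: ((G *m v^T) i 0) => a b; apply/eqP; rewrite eq_complex /nsq /=.
by apply/andP; split; apply/eqP; ring.
Qed.

Lemma colp_eq0 (w : 'cV[C]_n) : (forall i, nsq (w i 0) = 0) -> w = 0.
Proof. by move=> h; apply/colP => i; rewrite mxE; apply: nsq_eq0. Qed.

(** In the kernel identity the left side is real, while the imaginary part of the right side weighs
    the squared moduli of the entries of [G c] by [Im (y i) > 0]; hence [G c = 0]. *)
Lemma gdet_stable : stable gdet.
Proof.
move=> y yp; apply/eqP => /gdet_eq0_kernel[c Gc0 /(congr1 Im)].
rewrite ip_G_real cImN cIm_sum => /esym/eqP; rewrite oppr_eq0 => /eqP h.
case/eqP: Gc0; apply: colp_eq0 => i.
have : \sum_i Im (y i) * nsq ((G *m c) i 0) = 0.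
  rewrite -[RHS]oppr0 -[in RHS]h -sumrN; apply: eq_bigr => k _.
  by rewrite cImM cImConj /=; ring.
move/psumr_eq0P => /(_ (fun k _ => mulr_ge0 (ltW (yp k)) (nsq_ge0 _))) /(_ i isT).
by move/eqP; rewrite mulf_eq0 gt_eqF //= => /eqP.
Qed.

Lemma gdet_real : real_restriction gdetR gdet.
Proof.
move=> x; rewrite /gdetR; set d := gdet _.
suff : (d^*)%C = d.
  by case: d => a b [] e; apply/eqP; rewrite eq_complex /= eqxx; apply/eqP; lra.
rewrite /d /gdet /pencil -det_map_mx -[RHS]det_tr.
set Y := diag_mx _.
have hG : map_mx (@conjc R) G = G^T by apply/matrixP => i j; rewrite !mxE hermG.
have hY : map_mx (@conjc R) Y = Y.
  apply/matrixP => i j; rewrite !mxE ffunE rmorphMn /=.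
  by rewrite oppr0.
rewrite map_mxD map_mx1 map_mxM /= hG hY.
by rewrite det_1addmulmx linearD /= trmx1 trmx_mul tr_diag_mx.
Qed.

Lemma gdetR_multiaffine : multiaffine gdetR.
Proof. exact: real_restriction_multiaffine gdet_real gdet_multiaffine. Qed.

Lemma gdet0 : gdet 0 = 1.
Proof.
rewrite /gdet /pencil; set Y := diag_mx _; have -> : Y = 0.
  by apply/matrixP => i j; rewrite !mxE ffunE mul0rn.
by rewrite mul0mx addr0 det1.
Qed.

Lemma gdetR0 : gdetR 0 = 1.
Proof.
rewrite /gdetR; have -> : complex_pt 0 = 0 :> {ffun 'I_n -> C}.
  by apply/ffunP => i; rewrite !ffunE.
by rewrite gdet0.
Qed.

Lemma pdiff_gdetR0 i : pdiff i gdetR 0 = 1 / 4.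
Proof.
rewrite /pdiff gdetR0 add0r /gdetR complex_pt_axis /gdet /pencil.
have -> : diag_mx (\row_j axis i ((1 : R)%:C)%C j) *m G = delta_mx i 0 *m row i G.
  apply/matrixP => j k; rewrite mul_diag_mx !mxE big_ord1 !mxE ffunE eqxx andbT.
  by case: (eqVneq j i) => [->|]; rewrite ?mul0r.
rewrite det_1addmulmx det_mx11 !mxE (bigD1 i) //= big1 => [|j ji].
  by rewrite !mxE !eqxx diagG /=; lra.
by rewrite !mxE (negPf ji) mulr0.
Qed.

(** At a zero in the orthant, the kernel identity makes the form of [G] nonpositive at [c], and
    [boundG] then forces [G c = 0]. *)
Lemma gdetR_pos : pos_above gdetR 0.
Proof.
apply: pos_above_nonzero; first exact: gdetR_multiaffine.
  by rewrite gdetR0.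
move=> y y0; apply/eqP => gy.
have /gdet_eq0_kernel[c Gc0 h] : gdet (complex_pt y) = 0.
  by rewrite gdet_real gy.
have h1 : 0 <= \sum_i Re ((complex_pt y i)^*%C * ((nsq ((G *m c) i 0))%:C)%C).
  apply: sumr_ge0 => i _; rewrite ffunE cReM /= mulr0 subr0 mulr_ge0 ?nsq_ge0 //.
  by have := y0 i; rewrite ffunE.
have h2 : \sum_i nsq ((G *m c) i 0) = 0.
  apply/eqP; rewrite eq_le sumr_ge0 => [|i _]; last exact: nsq_ge0.
  rewrite andbT; apply: le_trans (boundG c) _; rewrite h cReN cRe_sum mulrN oppr_le0.
  by apply: mulr_ge0 => //; lra.
case/eqP: Gc0; apply: colp_eq0 => i.
by move/psumr_eq0P: h2; apply => // j _; apply: nsq_ge0.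
Qed.


(** * From determinants to Hermitian forms *)

Definition energy (y : {ffun 'I_n -> R}) (c : 'cV_n) : R :=
  Re (ip c (G *m c)) + \sum_i y i * nsq ((G *m c) i 0).

Lemma ipBr a b c : ip a (b - c) = ip a b - ip a c.
Proof. by rewrite /ip -sumrB; apply: eq_bigr => k _; rewrite !mxE mulrBr. Qed.

Lemma ipZr a b x : ip a (x *: b) = x * ip a b.
Proof. by rewrite /ip mulr_sumr; apply: eq_bigr => k _; rewrite !mxE mulrCA. Qed.

Lemma ipBl a b c : ip (a - b) c = ip a c - ip b c.
Proof. by rewrite -ipC ipBr rmorphB /= !ipC. Qed.

Lemma ipZl a b x : ip (x *: a) b = (x^*)%C * ip a b.
Proof. by rewrite -ipC ipZr rmorphM /= ipC. Qed.

Lemma ip_delta a i : ip a (delta_mx i 0) = ((a i 0)^*)%C.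
Proof.
rewrite /ip (bigD1 i) //= big1 => [|k ki].
  by rewrite mxE !eqxx mulr1 addr0.
by rewrite mxE (negPf ki) mulr0.
Qed.

Lemma ip_pencil y a b : ip (G *m a) (pencil (complex_pt y) *m b) =
  ip (G *m a) b + \sum_k ((y k)%:C)%C * ((((G *m a) k 0)^*)%C * (G *m b) k 0).
Proof.
rewrite /ip -big_split; apply: eq_bigr => k _.
by rewrite pencilE ffunE /= mulrDr mulrCA.
Qed.

Lemma ip_pencil_sym y a b :
  ((ip (G *m a) (pencil (complex_pt y) *m b))^*)%C =
  ip (G *m b) (pencil (complex_pt y) *m a).
Proof.
rewrite !ip_pencil rmorphD /= ipC ip_selfadjoint; congr (_ + _).
rewrite rmorph_sum; apply: eq_bigr => k _.
by rewrite !rmorphM /= conjcK oppr0; congr (_ * _); rewrite mulrC.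
Qed.

Lemma mulJ_nsq (x : C) : (x^*)%C * x = ((nsq x)%:C)%C.
Proof.
case: x => a b; apply/eqP; rewrite eq_complex /nsq /=.
by apply/andP; split; apply/eqP; ring.
Qed.

(** When [G] is the Gram matrix of vectors [v_i], both sides are the value of the form
    [1 + sum_i y_i v_i v_i^*] at [sum_i c_i v_i]. *)
Lemma energyE y c : energy y c = Re (ip (G *m c) (pencil (complex_pt y) *m c)).
Proof.
rewrite ip_pencil ip_selfadjoint /energy cReD.
congr (_ + _). rewrite cRe_sum; apply: eq_bigr => k _.
by rewrite mulJ_nsq cReM /= mulr0 subr0.
Qed.

Lemma energy_axis y i t c :
  energy (y + axis i t) c = energy y c + t * nsq ((G *m c) i 0).
Proof.
rewrite /energy -addrA; congr (_ + _).
under eq_bigr => k _ do rewrite ffunE mulrDl.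
rewrite big_split /=; congr (_ + _); rewrite (bigD1 i) //= big1 ?addr0.
  by rewrite axisE eqxx.
by move=> k ki; rewrite axisE (negPf ki) mul0r.
Qed.

(* Cauchy-Schwarz for the perturbed form, in which the vector [w] represents the
   functional [c |-> (G *m c) i 0] of the rank one perturbation. *)
Lemma energy_ge0_step y i t : 0 <= t ->
  0 < gdetR y * gdetR (y + axis i t) ->
  (forall c, 0 <= energy (y + axis i t) c) -> forall c, 0 <= energy y c.
Proof.
move=> t0 gg ypos c; set y' := y + axis i t in gg ypos.
set K := pencil (complex_pt y'); set T := ((t%:C)%C : C).
have g'0 : gdetR y' != 0 by apply: contraTneq gg => ->; rewrite mulr0 ltxx.
have uK : K \in unitmx.
  rewrite unitmxE unitfE -/(gdet _) gdet_real -[0]/((0 : R)%:C)%C.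
  by rewrite (inj_eq (@complexI R)).
set w := invmx K *m (delta_mx i 0 : 'cV[C]_n); set b := (G *m w) i 0.
have Kw : K *m w = delta_mx i 0 by rewrite mulKVmx.
have Ky : pencil (complex_pt y) = K *m (1%:M + w *m (- T *: row i G)).
  rewrite mulmxDr mulmx1 mulmxA Kw /K /pencil !mul_diag_mx; apply/matrixP => j k.
  rewrite !mxE big_ord1 !mxE !ffunE rmorphD /= eqxx andbT.
  rewrite [in RHS]rmorphMn /= -/T.
  by case: (eqVneq j i) => [->|_] /=; rewrite ?mulr0n ?mulr1n; ring.
(* Sylvester's identity reduces the rank one factor in [Ky] to a 1 by 1 determinant. *)
have gy : gdetR y = gdetR y' * (1 - t * Re b).
  apply: etrans (congr1 Re (_ : gdet (complex_pt y) = ((gdetR y')%:C)%C * (1 - T * b))) _.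
    rewrite /gdet Ky det_mulmx -/(gdet _) gdet_real; congr (_ * _).
    rewrite det_1addmulmx det_mx11 -scalemxAl !mxE mulNr /=; congr (_ - T * _).
    by rewrite [RHS]mxE; apply: eq_bigr => k _; rewrite mxE.
  by rewrite cReM /= mul0r subr0; congr (_ * _); case: (b) => b1 b2 /=; ring.
have tb : 0 < 1 - t * Re b.
  move: gg; rewrite gy mulrAC pmulr_rgt0 // -expr2 exprn_even_gt0 //.
set p := (G *m c) i 0; set N := nsq p.
(* At this vector the form of [y'] gives [energy y' c >= 2 * t * N - t ^+ 2 * N * Re b]; passing to
   [y] costs only [t * N], which [1 - t * Re b > 0] covers. *)
have := ypos (c - (T * p) *: w).
have -> : energy y' (c - (T * p) *: w) = energy y' c - 2 * t * N + t ^+ 2 * N * Re b.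
  have e1 : ip (G *m w) (K *m c) = p.
    by rewrite -ip_pencil_sym -/K Kw ip_delta conjcK.
  rewrite !energyE -/K !mulmxBr -!scalemxAr !(ipBr, ipBl, ipZr, ipZl).
  rewrite Kw e1 !ip_delta -/b -/p rmorphM /= oppr0 /N /nsq.
  case: (ip _ _) => i1 i2; case: (p) => p1 p2; case: (b) => b1 b2 /=; ring.
rewrite /y' !energy_axis -/p -/N => h.
have : 0 <= t * N * (1 - t * Re b) by rewrite !mulr_ge0 ?nsq_ge0 // ltW.
lra.
Qed.

(** At [y0 + 1], whose coordinates are nonnegative, the form is a sum of nonnegative terms; it is
    then brought down to [y0] one coordinate at a time. The hypothesis on products says that the
    determinant keeps one nonzero sign above [y0]. *)
Lemma energy_ge0 (y0 : {ffun 'I_n -> R}) : (forall i, -1 <= y0 i) ->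
  (forall y y', above y0 y -> above y0 y' -> 0 < gdetR y * gdetR y') ->
  forall c, 0 <= energy y0 c.
Proof.
move=> y1 gp.
suff H y : above y0 y -> (forall c, 0 <= energy y c) -> forall c, 0 <= energy y0 c.
  apply: (H [ffun i => y0 i + 1]) => [i|c]; first by rewrite ffunE lerDl.
  rewrite addr_ge0 ?ip_G_ge0 // sumr_ge0 // => i _.
  by rewrite mulr_ge0 ?nsq_ge0 // ffunE; have := y1 i; lra.
pose P y := (forall c, 0 <= energy y c) -> forall c, 0 <= energy y0 c.
move: y; apply: (@orthant_ind _ _ P) => [//|y i t y0y t0 IH h]; apply: IH.
apply: (energy_ge0_step t0 _ h); apply: gp => //.
exact: above_trans y0y (above_axis _ _ t0).
Qed.


(** * Two copies of the determinant, one per block *)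

Definition slice (K : Type) (b : bool) (z : {ffun bool * 'I_n -> K}) :
  {ffun 'I_n -> K} := [ffun i => z (b, i)].

Lemma slice_axis (K : zmodType) b b' j (t : K) z :
  slice b (z + axis (b', j) t) = if b == b' then slice b z + axis j t else slice b z.
Proof.
case: eqP => [->|/eqP bb']; apply/ffunP => i; rewrite !ffunE xpair_eqE ?eqxx //.
by rewrite (negPf bb') mulr0n addr0.
Qed.

Definition pair_det z := gdet (slice true z) * gdet (slice false z).
Definition pair_detR z := gdetR (slice true z) * gdetR (slice false z).

Lemma pair_detR_slice b z :
  pair_detR z = gdetR (slice b z) * gdetR (slice (~~ b) z).
Proof. by case: b; rewrite // /pair_detR mulrC. Qed.

Lemma pair_det_multiaffine : multiaffine pair_det.
Proof.
move=> [b j] z t; rewrite /pdiff /pair_det !slice_axis.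
case: b => /=; rewrite !gdet_multiaffine;
  move: (gdet _) (pdiff _ _ _) (gdet _) => x y u; ring.
Qed.

Lemma pair_det_stable : stable pair_det.
Proof.
by move=> z zp; rewrite mulf_neq0 // gdet_stable // => k; rewrite ffunE.
Qed.

Lemma pair_det_real : real_restriction pair_detR pair_det.
Proof.
have e b (x : {ffun bool * 'I_n -> R}) : slice b (complex_pt x) = complex_pt (slice b x).
  by apply/ffunP => i; rewrite !ffunE.
by move=> x; rewrite /pair_det !e !gdet_real -rmorphM.
Qed.

Lemma slice0 b : slice b (0 : {ffun bool * 'I_n -> R}) = 0.
Proof. by apply/ffunP => i; rewrite !ffunE. Qed.

Lemma pair_detR_pos : pos_above pair_detR 0.
Proof.
move=> x x0; have p b : 0 < gdetR (slice b x).
  by apply: gdetR_pos => i; have := x0 (b, i); rewrite !ffunE.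
exact: mulr_gt0.
Qed.

Lemma pair_detR_barrier k : pdiff k pair_detR 0 / pair_detR 0 <= 1 / 4.
Proof.
case: k => [b j]; rewrite /pdiff /pair_detR !slice_axis !slice0.
have e : gdetR (0 + axis j 1) = 1 + 1 / 4.
  by have := pdiff_gdetR0 j; rewrite /pdiff gdetR0; lra.
by case: b => /=; rewrite e gdetR0; lra.
Qed.

Lemma gram_partition : exists c : 'I_n -> bool, forall v b,
  \sum_(i | c i == b) nsq ((G *m v) i 0) <= 4 * Re (ip v (G *m v)).
Proof.
have [c pc] := exists_selection pair_det_real pair_det_multiaffine pair_det_stable
  pair_detR_pos pair_detR_barrier.
exists c => v b.
pose y0 : {ffun 'I_n -> R} := [ffun i => 2 / 3 - (b == c i)%:R].
have : 0 <= energy y0 v.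
  apply: energy_ge0 => [i|y y' hy hy'].
    by rewrite ffunE; case: eqP => _ /=; lra.
  (* [x u] puts [u] in block [b] and freezes the other block at the base point, so that the other
     determinant is a common factor [q] whose square can be cancelled. *)
  pose x (u : {ffun 'I_n -> R}) : {ffun bool * 'I_n -> R} :=
    [ffun k => if k.1 == b then u k.2 else 2 / 3 - (k.1 == c k.2)%:R].
  have xp u : above y0 u -> 0 < pair_detR (x u).
    move=> hu; apply: pc => -[b' i]; rewrite !ffunE /=.
    by have [->|_] := eqVneq b' b; first by have := hu i; rewrite ffunE.
  have := mulr_gt0 (xp _ hy) (xp _ hy').
  have sb u : slice b (x u) = u by apply/ffunP => i; rewrite !ffunE eqxx.
  have snb u u' : slice (~~ b) (x u) = slice (~~ b) (x u').
    by apply/ffunP => i; rewrite !ffunE /=; case: (b).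
  have pE u : pair_detR (x u) = gdetR u * gdetR (slice (~~ b) (x u)).
    by rewrite (pair_detR_slice b) sb.
  rewrite !pE (snb y' y); move: (gdetR (slice _ _)) => q h.
  have : 0 < (gdetR y * gdetR y') * q ^+ 2 by rewrite expr2; move: h; rewrite mulrACA.
  have q0 : q != 0 by apply: contraTneq h => ->; rewrite mulr0 mul0r ltxx.
  by rewrite pmulr_lgt0 // exprn_even_gt0.
rewrite /energy.
have -> : \sum_i y0 i * nsq ((G *m v) i 0) =
    2 / 3 * \sum_i nsq ((G *m v) i 0) - \sum_(i | c i == b) nsq ((G *m v) i 0).
  rewrite mulr_sumr [in X in _ - X]big_mkcond -sumrB; apply: eq_bigr => i _.
  by rewrite ffunE eq_sym; case: eqP => _ /=; ring.
(* The constant is [1 + (2 / 3) * (9 / 2) = 4]. *)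
have := boundG v; lra.
Qed.

End Gram.

(** * Infinite families *)

Section Compactness.
Variables (R : realType) (I : choiceType) (X : Type) (A : X -> I -> R) (B : X -> R).
Hypothesis A0 : forall x i, 0 <= A x i.

Lemma big_subseq_le (P : pred I) (F : I -> R) (s t : seq I) :
  (forall i, 0 <= F i) -> uniq s -> uniq t -> {subset s <= t} ->
  \sum_(i <- s | P i) F i <= \sum_(i <- t | P i) F i.
Proof.
move=> F0 us ut st.
have pt : perm_eq t (s ++ [seq i <- t | i \notin s]).
  apply: uniq_perm => //.
    rewrite cat_uniq us filter_uniq // andbT /=.
    by apply/hasPn => i; rewrite mem_filter => /andP[].
  move=> i; rewrite mem_cat mem_filter.
  by case: (boolP (i \in s)) => [/st ->|].
by rewrite (perm_big _ pt) big_cat lerDl sumr_ge0.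
Qed.

Hypothesis finite_choice : forall s : seq I, uniq s ->
  exists c : I -> bool, forall x (b : bool), \sum_(i <- s | c i == b) A x i <= B x.

(** The finite choices [cs s] converge pointwise along an ultrafilter [U] containing, for each list,
    the set of its duplicate-free extensions. On a finite [s] the limit agrees with [cs t] for some
    [t] containing [s], and by nonnegativity the sum over [t] dominates. *)
Lemma compact_choice : exists c : I -> bool,
  forall x (b : bool) s, uniq s -> \sum_(i <- s | c i == b) A x i <= B x.
Proof.
have [cs hcs] : exists cs : seq I -> I -> bool, forall s, uniq s ->
    forall x (b : bool), \sum_(i <- s | cs s i == b) A x i <= B x.
  have h s : exists c : I -> bool, uniq s ->
      forall x (b : bool), \sum_(i <- s | c i == b) A x i <= B x.
    case: (boolP (uniq s)) => us; last by exists (fun=> true).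
    by have [c hc] := finite_choice us; exists c.
  by have [cs hcs] := choice h; exists cs.
pose F : set_system (seq I) :=
  [set P | exists s0 : seq I, forall s : seq I, uniq s -> {subset s0 <= s} -> P s].
have FF : ProperFilter F.
  split.
    move=> [s0 /(_ (undup s0))]; apply; first exact: undup_uniq.
    by move=> i; rewrite mem_undup.
  split.
  - by exists [::].
  - move=> P Q [s hs] [t ht]; exists (s ++ t) => r ur str; split.
      by apply: hs => // i si; apply: str; rewrite mem_cat si.
    by apply: ht => // i si; apply: str; rewrite mem_cat si orbT.
  - by move=> P Q PQ [s hs]; exists s => r ur sr; apply/PQ/hs.
have [U [UU FU]] := ultraFilterLemma FF.
pose c i : bool := `[< U [set s | cs s i] >].
exists c => x b s us.
have Uc i : U [set t | cs t i = c i].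
  rewrite /c; case: (asboolP (U [set t | cs t i])) => h.
    by apply: filterS h => t /= ->.
  have [//|] := in_ultra_setVsetC [set t | cs t i] UU.
  by apply: filterS => t /= /negP/negbTE.
have Us : U [set t | forall i, i \in s -> cs t i = c i].
  elim: s {us} => [|i s IH]; first by apply: filterS filterT.
  apply: filterS (filterI (Uc i) IH) => t [h1 h2] j.
  by rewrite inE => /orP[/eqP -> //|/h2].
have Ut : U [set t | uniq t /\ {subset s <= t}].
  by apply: FU; exists s => t ut st.
have [t [h1 [ut st]]] := filter_ex (filterI Us Ut).
apply: le_trans (hcs t ut x b).
apply: le_trans (big_subseq_le (fun i => cs t i == b) (A0 x) us ut st).
rewrite le_eqVlt; apply/orP; left; apply/eqP.
rewrite [LHS]big_seq_cond [RHS]big_seq_cond; apply: eq_bigl => i.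
by case: (boolP (i \in s)) => //= /h1 ->.
Qed.

Lemma esum_le_of_seq (S : set I) (F : I -> R) (b : R) :
  (forall s, uniq s -> (forall i, i \in s -> S i) -> \sum_(i <- s) F i <= b) ->
  (\esum_(i in S) (F i)%:E <= b%:E)%E.
Proof.
move=> h; apply: ereal.ge_ereal_sup => _ [D [fD DS] <-].
rewrite fsbig_finite //= sumEFin lee_fin; apply: h; first exact: fset_uniq.
by move=> i; rewrite in_fset_set // => /set_mem/DS.
Qed.

Lemma seq_le_esum (F : I -> R) s : uniq s ->
  ((\sum_(i <- s) F i)%:E <= \esum_(i in [set: I]) (F i)%:E)%E.
Proof.
move=> us; apply: esum_ge; exists [set` s]; first by split => //; exact: finite_seq.
by rewrite -fsbig_seq // sumEFin.
Qed.

End Compactness.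

(** * Hilbert spaces *)

(** The finite problem in terms of the Gram matrix alone, with [theta] as conjugation, so that real
    and complex scalars share the Hilbert space argument. *)
Definition paving (K : numFieldType) (theta : K -> K) : Prop :=
  forall (n : nat) (G : 'M[K]_n),
    (forall i j, G i j = theta (G j i)) -> (forall i, G i i = 1) ->
    (forall v : 'cV_n, \sum_i `|(G *m v) i 0| ^+ 2
       <= 18 * \sum_i theta (v i 0) * (G *m v) i 0) ->
    exists c : 'I_n -> bool, forall (v : 'cV_n) b,
      \sum_(i | c i == b) `|(G *m v) i 0| ^+ 2
        <= 16 * \sum_i theta (v i 0) * (G *m v) i 0.

Section Hilbert.
Variables (K : numFieldType) (theta : {rmorphism K -> K}) (H : normedModType K).
Variables (dot : H -> H -> K).
Hypothesis norm_theta : forall a : K, `|a| ^+ 2 = a * theta a.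
Hypothesis dotDl : forall x y z, dot (x + y) z = dot x z + dot y z.
Hypothesis dotZl : forall a x z, dot (a *: x) z = a * dot x z.
Hypothesis dotC : forall x y, dot x y = theta (dot y x).
Hypothesis dotxx : forall x, dot x x = `|x| ^+ 2.

Lemma dotBl x y z : dot (x - y) z = dot x z - dot y z.
Proof. by rewrite -scaleN1r dotDl dotZl mulN1r. Qed.

Lemma dotBr x y z : dot z (x - y) = dot z x - dot z y.
Proof. by rewrite dotC dotBl rmorphB /= -!dotC. Qed.

Lemma dotZr a x z : dot z (a *: x) = theta a * dot z x.
Proof. by rewrite dotC dotZl rmorphM /= -dotC. Qed.

Lemma dot0l z : dot 0 z = 0.
Proof. by rewrite -(scale0r 0) dotZl mul0r. Qed.

Lemma dot_suml (J : Type) (s : seq J) (P : pred J) (F : J -> H) z :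
  dot (\sum_(j <- s | P j) F j) z = \sum_(j <- s | P j) dot (F j) z.
Proof. exact: (big_morph (dot^~ z) (fun x y => dotDl x y z) (dot0l z)). Qed.

Lemma dot_sumr (J : Type) (s : seq J) (P : pred J) (F : J -> H) z :
  dot z (\sum_(j <- s | P j) F j) = \sum_(j <- s | P j) dot z (F j).
Proof.
by rewrite dotC dot_suml rmorph_sum; apply: eq_bigr => j _; rewrite /= -dotC.
Qed.

Lemma dotxx_ge0 x : 0 <= dot x x.
Proof. by rewrite dotxx exprn_ge0. Qed.

Lemma theta_nat n : theta n%:R = n%:R.
Proof. exact: rmorph_nat. Qed.

Lemma theta_inv16 : theta (16^-1) = 16^-1.
Proof. by rewrite fmorphV theta_nat. Qed.

(** The Gram matrix only controls vectors in the span of the [u i]; this reduces an arbitrary [x] to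
    its image [v] under the frame operator of the block. The bound combines the hypothesis with the
    nonnegativity of the squared norm of [x - v / 16] and of the squared moduli of its
    coefficients. *)
Lemma bessel_of_synthesis (J : finType) (P : pred J) (u : J -> H) (x : H) :
  let v := \sum_(i | P i) dot x (u i) *: u i in
  \sum_(i | P i) `|dot v (u i)| ^+ 2 <= 16 * `|v| ^+ 2 ->
  \sum_(i | P i) `|dot x (u i)| ^+ 2 <= 16 * `|x| ^+ 2.
Proof.
move=> v; set S := \sum_(i | P i) `|dot x _| ^+ 2; set N := \sum_(i | P i) _ => hN.
have xv : dot x v = S.
  rewrite /v dot_sumr; apply: eq_bigr => i _.
  by rewrite dotZr norm_theta mulrC.
have vx : dot v x = S.
  rewrite /v dot_suml; apply: eq_bigr => i _.
  by rewrite dotZl norm_theta (dotC (u i)).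
have vv : dot v v = \sum_(i | P i) dot x (u i) * theta (dot v (u i)).
  by rewrite {1}/v dot_suml; apply: eq_bigr => i _; rewrite dotZl (dotC (u i)).
have vv' : dot v v = \sum_(i | P i) theta (dot x (u i)) * dot v (u i).
  by rewrite {2}/v dot_sumr; apply: eq_bigr => i _; rewrite dotZr.
have h1 : 0 <= \sum_(i | P i) `|dot x (u i) - 16^-1 * dot v (u i)| ^+ 2.
  by apply: sumr_ge0 => i _; rewrite exprn_ge0.
have e1 : \sum_(i | P i) `|dot x (u i) - 16^-1 * dot v (u i)| ^+ 2 =
    S - 16^-1 * dot v v - 16^-1 * dot v v + 16^-1 * 16^-1 * N.
  rewrite {1}vv vv' !mulr_sumr -!sumrB -big_split; apply: eq_bigr => i _ /=.
  rewrite !norm_theta rmorphB rmorphM /= theta_inv16; ring.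
have h2 : 0 <= dot (x - 16^-1 *: v) (x - 16^-1 *: v) by apply: dotxx_ge0.
have e2 : dot (x - 16^-1 *: v) (x - 16^-1 *: v) =
    dot x x - 16^-1 * S - 16^-1 * S + 16^-1 * 16^-1 * dot v v.
  by rewrite !(dotBl, dotBr, dotZl, dotZr) xv vx theta_inv16; ring.
move: hN h1 h2; rewrite e1 e2 -!dotxx => hN h1 h2.
have {}h1 : 0 <= 256 * (S - 16^-1 * dot v v - 16^-1 * dot v v + 16^-1 * 16^-1 * N).
  exact: mulr_ge0 (ler0n _ 256) h1.
have {}h2 : 0 <= 256 * (dot x x - 16^-1 * S - 16^-1 * S + 16^-1 * 16^-1 * dot v v).
  exact: mulr_ge0 (ler0n _ 256) h2.
have n16 : (16 : K) != 0 by rewrite pnatr_eq0.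
have E1 : 256 * (S - 16^-1 * dot v v - 16^-1 * dot v v + 16^-1 * 16^-1 * N)
  = 256 * S - 32 * dot v v + N by field.
have E2 : 256 * (dot x x - 16^-1 * S - 16^-1 * S + 16^-1 * 16^-1 * dot v v)
  = 256 * dot x x - 32 * S + dot v v by field.
rewrite E1 in h1; rewrite E2 in h2.
rewrite -subr_ge0 -(pmulr_rge0 _ (ltr0Sn K 255)).
have -> : 256 * (16 * dot x x - S) = (16 * dot v v - N)
  + (256 * S - 32 * dot v v + N) + 16 * (256 * dot x x - 32 * S + dot v v) by ring.
apply: addr_ge0; last by apply: mulr_ge0.
by apply: addr_ge0 => //; rewrite subr_ge0.
Qed.

Hypothesis pav : paving theta.

Lemma finite_partition (n : nat) (u : 'I_n -> H) :
  (forall i, `|u i| = 1) ->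
  (forall x, \sum_i `|dot x (u i)| ^+ 2 <= 18 * `|x| ^+ 2) ->
  exists c : 'I_n -> bool, forall x b,
    \sum_(i | c i == b) `|dot x (u i)| ^+ 2 <= 16 * `|x| ^+ 2.
Proof.
move=> u1 uB; pose G : 'M[K]_n := \matrix_(i, j) dot (u j) (u i).
pose syn (v : 'cV[K]_n) := \sum_j v j 0 *: u j.
have GE (v : 'cV_n) i : (G *m v) i 0 = dot (syn v) (u i).
  rewrite dot_suml mxE; apply: eq_bigr => j _.
  by rewrite mxE dotZl mulrC.
have nE (v : 'cV_n) : \sum_i theta (v i 0) * (G *m v) i 0 = `|syn v| ^+ 2.
  rewrite -dotxx {2}/syn dot_sumr; apply: eq_bigr => i _.
  by rewrite dotZr GE.
have [||v|c hc] := pav (G := G).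
- by move=> i j; rewrite !mxE -dotC.
- by move=> i; rewrite !mxE dotxx u1 expr1n.
- by rewrite nE; apply: le_trans (uB (syn v)); apply: ler_sum => i _; rewrite GE.
exists c => x b; apply: bessel_of_synthesis.
(* The coefficients of [x], cut off outside the block, synthesize to the vector [v] of
   [bessel_of_synthesis]. *)
pose a : 'cV[K]_n := \col_i (if c i == b then dot x (u i) else 0).
have -> : \sum_(i | c i == b) dot x (u i) *: u i = syn a.
  rewrite /syn big_mkcond; apply: eq_bigr => i _.
  by rewrite mxE; case: eqP; rewrite ?scale0r.
rewrite -nE; apply: le_trans (hc a b); apply: ler_sum => i _.
by rewrite GE.
Qed.

Lemma seq_partition (I : choiceType) (u : I -> H) (s : seq I) :
  (forall i, `|u i| = 1) ->
  (forall x, \sum_(i <- s) `|dot x (u i)| ^+ 2 <= 18 * `|x| ^+ 2) ->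
  uniq s -> exists c : I -> bool, forall x b,
    \sum_(i <- s | c i == b) `|dot x (u i)| ^+ 2 <= 16 * `|x| ^+ 2.
Proof.
move=> u1 uB us.
have [||c hc] := @finite_partition (size s) (fun k => u (tnth (in_tuple s) k)).
- by move=> k; apply: u1.
- by move=> x; have := uB x; rewrite big_tnth.
exists (fun i => if insub (index i s) is Some k then c k else true) => x b.
rewrite big_tnth; apply: le_trans (hc x b).
rewrite le_eqVlt; apply/orP; left; apply/eqP; apply: eq_bigl => k.
have -> : index (tnth (in_tuple s) k) s = k.
  by rewrite (tnth_nth (tnth (in_tuple s) k)) index_uniq.
by rewrite valK.
Qed.

Variables (R : realType) (re : K -> R).
Hypothesis reD : forall x y, re (x + y) = re x + re y.
Hypothesis re_mono : forall x y, 0 <= x -> 0 <= y -> (re x <= re y) = (x <= y).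

Lemma re0 : re 0 = 0.
Proof. by have := reD 0 0; rewrite addr0; lra. Qed.

Lemma re_nat n x : re (n%:R * x) = n%:R * re x.
Proof.
elim: n => [|n IH]; first by rewrite !mul0r re0.
by rewrite -!natr1 !mulrDl !mul1r reD IH.
Qed.

Lemma re_sum (J : Type) (s : seq J) (P : pred J) (F : J -> K) :
  re (\sum_(j <- s | P j) F j) = \sum_(j <- s | P j) re (F j).
Proof. exact: (big_morph re reD re0). Qed.

Lemma frame_partition (I : choiceType) (u : I -> H) :
  (forall i, `|u i| = 1) -> is_tight_frame re dot [set: I] u 18 ->
  exists S1 S2 : set I, is_partition2 S1 S2 /\
    is_frame re dot S1 u 2 16 /\ is_frame re dot S2 u 2 16.
Proof.
move=> u1 [_ [_ uF]].
have sq0 (a : K) : 0 <= `|a| ^+ 2 by rewrite exprn_ge0.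
have nrm0 (x : H) : 0 <= `|x| ^+ 2 by rewrite exprn_ge0.
have re_ge0 a : 0 <= a -> 0 <= re a by move=> a0; rewrite -re0 re_mono.
pose A x i := re (`|dot x (u i)| ^+ 2).
have A0 x i : 0 <= A x i by apply: re_ge0.
have [s us|c hc] := @compact_choice R I H A (fun x => 16 * re (`|x| ^+ 2)) A0.
  have [x|c hc] := @seq_partition I u s u1 _ us.
    rewrite -re_mono ?mulr_ge0 ?sumr_ge0 // re_nat re_sum.
    have [_] := uF x; rewrite -lee_fin; apply: le_trans.
    exact: (seq_le_esum (A x)).
  exists c => x b; have := hc x b.
  by rewrite -re_mono ?mulr_ge0 ?sumr_ge0 // re_nat re_sum.
pose S b := [set i | c i = b].
have up b x : (\esum_(i in S b) (A x i)%:E <= (16 * re (`|x| ^+ 2))%:E)%E.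
  apply: esum_le_of_seq => s us sS; apply: le_trans (hc x b s us).
  rewrite [leLHS]big_seq_cond [leRHS]big_seq_cond le_eqVlt; apply/orP; left; apply/eqP.
  apply: eq_bigl => i; case: (boolP (i \in s)) => [/sS si|//].
  by rewrite (si : c i = b) eqxx.
have SE b : S (~~ b) = ~` S b.
  by apply/seteqP; split=> i; rewrite /S /=; case: (c i); case: b.
(* The total 18 minus the bound 16 on the complementary block; finite and infinite sums are
   separated before subtracting. *)
have lo b x : ((2 * re (`|x| ^+ 2))%:E <= \esum_(i in S b) (A x i)%:E)%E.
  have [h _] := uF x; have := up (~~ b) x; move: h.
  rewrite (@esumID _ _ (S b)) => [|i _]; last by rewrite lee_fin A0.
  rewrite !setTI -SE.
  have : (0 <= \esum_(i in S b) (A x i)%:E)%E.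
    by apply: esum_ge0 => i _; rewrite lee_fin.
  have : (0 <= \esum_(i in S (~~ b)) (A x i)%:E)%E.
    by apply: esum_ge0 => i _; rewrite lee_fin.
  rewrite -/(A x).
  case: (esum (S b) _) => [p| |]; case: (esum (S (~~ b)) _) => [q| |] //=.
  - rewrite -!EFinD !lee_fin; lra.
  - by move=> _ _ _ _; rewrite leey.
have fr b : is_frame re dot (S b) u 2 16.
  split; first by lra.
  by split; [lra | move=> x; split; [exact: lo | exact: up]].
exists (S true), (S false); split; last by split; exact: fr.
split; last by rewrite (SE true) setICr.
by rewrite (SE true) setUCr.
Qed.

End Hilbert.

(** * The Gram matrix bound over the complex and the real numbers *)

Section Paving.
Variable R : rcfType.
Local Notation C := (complex R).
Local Notation Re := (@complex.Re R).
Local Notation Im := (@complex.Im R).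

Lemma nsq_scale (x : C) : nsq (4^-1 * x) = nsq x / 16.
Proof.
have -> : (4^-1 : C) = ((4^-1 : R)%:C)%C by rewrite fmorphV rmorph_nat.
by case: x => a b; rewrite /nsq /=; field.
Qed.

(** Scaling [G] by 1/4 divides squared entries of [G v] by 16 and the form by 4: the constant 18
    becomes 9/2, and the resulting 4 goes back to 16. *)
Lemma gram_partition16 (n : nat) (G : 'M[C]_n) :
  (forall i j, ((G i j)^*)%C = G j i) -> (forall i, G i i = 1) ->
  (forall v : 'cV_n, \sum_i nsq ((G *m v) i 0) <= 18 * Re (ip v (G *m v))) ->
  exists c : 'I_n -> bool, forall v b,
    \sum_(i | c i == b) nsq ((G *m v) i 0) <= 16 * Re (ip v (G *m v)).
Proof.
move=> hG dG bG; pose G4 := 4^-1 *: G.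
have q : (4^-1 : C) = ((4^-1 : R)%:C)%C by rewrite fmorphV rmorph_nat.
have nE (v : 'cV_n) i : nsq ((G4 *m v) i 0) = nsq ((G *m v) i 0) / 16.
  by rewrite -scalemxAl mxE nsq_scale.
have iE (v : 'cV_n) : Re (ip v (G4 *m v)) = Re (ip v (G *m v)) / 4.
  by rewrite -scalemxAl ipZr q; case: (ip _ _) => a b /=; field.
have [||v|c hc] := @gram_partition R n G4.
- move=> i j; rewrite !mxE -(hG i j) q; case: (G i j) => a b; apply/eqP.
  by rewrite eq_complex /=; apply/andP; split; apply/eqP; ring.
- by move=> i; rewrite !mxE dG mulr1 q; congr (_%:C)%C; field.
- under eq_bigr => i _ do rewrite nE.
  by rewrite -mulr_suml iE; have := bG v; lra.
exists c => v b; have := hc v b.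
under eq_bigr => i _ do rewrite nE.
by rewrite -mulr_suml iE; lra.
Qed.

Lemma sum_normsq (n : nat) (P : pred 'I_n) (F : 'I_n -> C) :
  \sum_(i | P i) `|F i| ^+ 2 = ((\sum_(i | P i) nsq (F i))%:C)%C.
Proof.
by rewrite rmorph_sum; apply: eq_bigr => i _; rewrite -add_Re2_Im2.
Qed.

Lemma paving_complex : @paving C Num.conj.
Proof.
move=> n G hG dG bG.
have hG' i j : ((G i j)^*)%C = G j i by rewrite [RHS]hG.
have ipE (v : 'cV_n) :
    \sum_i Num.conj (v i 0) * (G *m v) i 0 = ((Re (ip v (G *m v)))%:C)%C.
  rewrite -[LHS]/(ip v (G *m v)); apply/eqP; rewrite eq_complex /= eqxx /=.
  by rewrite (ip_G_real hG').
have [v|c hc] := gram_partition16 hG' dG.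
  have := bG v; rewrite ipE sum_normsq.
  by rewrite -[18]/((18%:R : C)) -(rmorph_nat (real_complex R)) -rmorphM lecR.
exists c => v b; rewrite ipE sum_normsq.
by rewrite -[16]/((16%:R : C)) -(rmorph_nat (real_complex R)) -rmorphM lecR.
Qed.

(** For a real matrix the real and imaginary parts of a complex vector decouple, so the hypothesis
    complexifies; the conclusion is then read at real vectors. *)
Lemma paving_real : @paving R idfun.
Proof.
move=> n G hG dG bG; pose Gc : 'M[C]_n := map_mx (real_complex R) G.
pose rp (v : 'cV[C]_n) : 'cV[R]_n := map_mx Re v.
pose jp (v : 'cV[C]_n) : 'cV[R]_n := map_mx Im v.
have GcE (v : 'cV_n) i : (Gc *m v) i 0 = ((G *m rp v) i 0 +i* (G *m jp v) i 0)%C.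
  apply/eqP; rewrite eq_complex !mxE cRe_sum cIm_sum; apply/andP.
  by split; apply/eqP; apply: eq_bigr => j _; rewrite !mxE; case: (v j 0) => a b /=; ring.
have nE (v : 'cV_n) i :
    nsq ((Gc *m v) i 0) = `|(G *m rp v) i 0| ^+ 2 + `|(G *m jp v) i 0| ^+ 2.
  by rewrite GcE !real_normK ?num_real.
have iE (v : 'cV_n) : Re (ip v (Gc *m v)) = \sum_i rp v i 0 * (G *m rp v) i 0
    + \sum_i jp v i 0 * (G *m jp v) i 0.
  rewrite cRe_sum -big_split; apply: eq_bigr => i _ /=.
  by rewrite GcE cReM cReConj cImConj !mxE /=; ring.
have [||v|c hc] := @gram_partition16 n Gc.
- by move=> i j; rewrite !mxE conjc_real hG.
- by move=> i; rewrite !mxE dG.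
- under eq_bigr => i _ do rewrite nE.
  by rewrite big_split iE mulrDr lerD.
exists c => v b; have := hc (map_mx (real_complex R) v) b.
under eq_bigr => i _ do rewrite nE.
have rpE : rp (map_mx (real_complex R) v) = v by apply/colP => i; rewrite !mxE.
have jpE : jp (map_mx (real_complex R) v) = 0 by apply/colP => i; rewrite !mxE.
rewrite iE rpE jpE mulmx0 [X in _ + X]big1 ?addr0 => [|i _]; last by rewrite mxE mul0r.
by apply: le_trans; apply: ler_sum => i _; rewrite lerDl exprn_ge0.
Qed.

End Paving.

Theorem theorem5p1 (R : realType) :
  (forall (H : completeNormedModType R) (dot : {dot H for idfun})
      (I : choiceType) (u : I -> H),
    induces_norm dot ->
    (forall i : I, `|u i| = 1) ->
    is_tight_frame idfun dot [set: I] u (18 : R) ->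
    exists S1 S2 : set I,
      is_partition2 S1 S2 /\
      is_frame idfun dot S1 u (2 : R) (16 : R) /\
      is_frame idfun dot S2 u (2 : R) (16 : R))
  /\
  (forall (H : completeNormedModType (complexField R)) (dot : {dot H for Num.conj})
      (I : choiceType) (u : I -> H),
    induces_norm dot ->
    (forall i : I, `|u i| = 1) ->
    is_tight_frame (@complex.Re R) dot [set: I] u (18 : R) ->
    exists S1 S2 : set I,
      is_partition2 S1 S2 /\
      is_frame (@complex.Re R) dot S1 u (2 : R) (16 : R) /\
      is_frame (@complex.Re R) dot S2 u (2 : R) (16 : R)).
Proof.
split=> H dot I u nrm u1 uF.
- have dC x y : dot x y = dot y x.
    by rewrite (@hermitian_subproof _ _ _ _ dot) expr0 mul1r.
  apply: (@frame_partition R idfun H dot) => //.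
  + by move=> a; rewrite real_normK ?num_real // expr2.
  + by move=> x y z; rewrite linearDl.
  + by move=> a x z; rewrite linearZl_LR.
  + exact: paving_real.
- have dC x y : dot x y = Num.conj (dot y x).
    by rewrite (@hermitian_subproof _ _ _ _ dot) expr0 mul1r.
  apply: (@frame_partition (complexField R) Num.conj H dot) => //.
  + by move=> a; rewrite normCK.
  + by move=> x y z; rewrite linearDl.
  + by move=> a x z; rewrite linearZl_LR.
  + exact: paving_complex.
  + by case=> a b [c d].
  + case=> a b [c d]; rewrite !lecE /= => /andP[/eqP <- _] /andP[/eqP <- _].
    by rewrite eqxx.
Qed.
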